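(* Let $\varphi:\mathbb{R}^n\to\overline{\mathbb{R}}$ be an l.s.c. and prox-bounded function with $\bar x\in\operatorname{dom}\varphi$, and let $\bar v\in\partial\varphi(\bar x)$. Then the following assertions are equivalent: (i) $\varphi$ is variationally strongly convex at $\bar x$ for $\bar v$ (with some modulus $\sigma>0$). (ii) $\varphi$ is prox-regular at $\bar x$ for $\bar v$, and for all sufficiently small $\lambda>0$ the Moreau envelope $e_\lambda\varphi$ is locally strongly convex around $\bar x+\lambda\bar v$ (with some modulus $\sigma_\lambda>0$ which may depend on $\lambda$).
   Context: Conventions: $\overline{\mathbb{R}}:=(-\infty,\infty]$; every extended-real-valued function is assumed proper, i.e. $\operatorname{dom}\varphi:=\{x\mid\varphi(x)<\infty\}\neq\emptyset$. $\mathbb{B}_\epsilon(a)$ is the closed ball with center $a$ and radius $\epsilon$; l.s.c. means lower semicontinuous. Subdifferentials: for $\bar x\in\operatorname{dom}\varphi$, the regular subdifferential is $$\widehat\partial\varphi(\bar x)=\Big\{v\in\mathbb{R}^n\;\Big|\;\liminf_{x\to\bar x}\frac{\varphi(x)-\varphi(\bar x)-\langle v,x-\bar x\rangle}{\|x-\bar x\|}\ge 0\Big\},$$ and the limiting subdifferential $\partial\varphi(\bar x)$ is the set of all $v$ for which there are $x_k\to\bar x$ with $\varphi(x_k)\to\varphi(\bar x)$ and $v_k\in\widehat\partial\varphi(x_k)$ with $v_k\to v$. Strong convexity: a function $\psi$ is strongly convex on a convex set $\Omega$ with modulus $\kappa>0$ if $\psi-\frac\kappa2\|\cdot\|^2$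 is convex on $\Omega$. Locally strongly convex around a point means strongly convex (with some modulus) on some convex neighborhood of that point. Variational strong convexity: an l.s.c. function $\varphi$ is variationally strongly convex at $\bar x$ for $\bar v\in\partial\varphi(\bar x)$ with modulus $\sigma>0$ if for some convex neighborhood $U\times V$ of $(\bar x,\bar v)$ there exist an l.s.c. function $\psi\le\varphi$ on $U$, strongly convex on $U$ with modulus $\sigma$, and a number $\epsilon>0$ such that $$(U_\epsilon\times V)\cap\operatorname{gph}\partial\varphi=(U\times V)\cap\operatorname{gph}\partial\psi\quad\text{and}\quad\varphi(x)=\psi(x)\ \text{at the common elements }(x,v),$$ where $U_\epsilon:=\{x\in U\mid\varphi(x)<\varphi(\bar x)+\epsilon\}$. Prox-regularity: an l.s.c. function $\varphi$ is prox-regular at $\bar x\in\operatorname{dom}\varphi$ for $\bar v\in\partial\varphi(\bar x)$ if there exist $\epsilon>0$ and $r\ge0$ such that $\varphi(x)\ge\varphi(u)+\langle v,x-u\rangle-\frac r2\|x-u\|^2$ for all $x\in\mathbb{B}_\epsilon(\bar x)$ and all $(u,v)\in\operatorname{gph}\partial\varphi\cap(\mathbb{B}_\epsilon(\bar x)\times\mathbb{B}_\epsilon(\bar v))$ with $\varphi(u)<\varphi(\bar x)+\epsilon$. Moreau envelope: $e_\lambda\varphi(x):=\inf_{y\in\mathbb{R}^n}\{\varphi(y)+\frac1{2\lambda}\|y-x\|^2\}$ for $\lambda>0$. The function $\varphi$ is prox-bounded if there is $\lambda>0$ with $e_\lambda\varphi(x)>-\infty$ for some $x\in\mathbb{R}^n$.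 *)

(* Defs.v *)
From HB Require Import structures.
From mathcomp Require Import all_boot all_order all_algebra.
From mathcomp Require Import all_classical all_reals all_analysis.

Set Implicit Arguments.
Unset Strict Implicit.
Unset Printing Implicit Defensive.

Import Order.TTheory GRing.Theory Num.Theory.
Import numFieldNormedType.Exports.

Local Open Scope classical_set_scope.
Local Open Scope ring_scope.

Definition dotv (R : realType) (n : nat) (u v : 'rV[R]_n) : R :=
  \sum_(i < n) u ord0 i * v ord0 i.

(* The library norm [`|x|] on ['rV[R]_n] is the max norm. It induces the same
   topology as the Euclidean norm, so [nbhs], [-->] and
   [lower_semicontinuous] are used as provided; every quantitative expression
   below uses [enorm]. *)
Definition enorm (R : realType) (n : nat) (x : 'rV[R]_n) : R :=
  Num.sqrt (dotv x x).

Definition eball (R : realType) (n : nat) (a : 'rV[R]_n) (eps : R) :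
    set 'rV[R]_n :=
  [set x | enorm (x - a) <= eps].

Definition edom (R : realType) (n : nat) (f : 'rV[R]_n -> \bar R) :
    set 'rV[R]_n :=
  [set x | (f x < +oo)%E].

(* The first conjunct expresses that [f] takes its values in (-oo, +oo]. *)
Definition proper_fun (R : realType) (n : nat) (f : 'rV[R]_n -> \bar R) : Prop :=
  (forall x, f x != -oo%E) /\ edom f !=set0.

Definition regular_subdiff (R : realType) (n : nat) (f : 'rV[R]_n -> \bar R)
    (x : 'rV[R]_n) : set 'rV[R]_n :=
  [set v | edom f x /\
    (0 <= limf_einf (fun y : 'rV[R]_n =>
        (f y - f x - (dotv v (y - x))%:E) * ((enorm (y - x))^-1)%:E) x^')%E].

Definition limiting_subdiff (R : realType) (n : nat) (f : 'rV[R]_n -> \bar R)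
    (x : 'rV[R]_n) : set 'rV[R]_n :=
  [set v | edom f x /\
    exists (xk vk : nat -> 'rV[R]_n),
      [/\ xk @ \oo --> x,
          (fun k => f (xk k)) @ \oo --> f x,
          forall k, regular_subdiff f (xk k) (vk k) &
          vk @ \oo --> v]].

Definition gph (T T' : Type) (S : T -> set T') : set (T * T') :=
  [set p | S p.1 p.2].

(* Extended-real-valued counterpart of the library's [convex_function]; since
   [0 * +oo = 0], the endpoints [t = 0, 1] hold trivially. *)
Definition econvex_on (R : realType) (n : nat) (D : set 'rV[R]_n)
    (f : 'rV[R]_n -> \bar R) : Prop :=
  forall (x y : 'rV[R]_n) (t : R), D x -> D y -> 0 <= t <= 1 ->
    (f (t *: x + (1 - t) *: y)%R <= t%:E * f x + (1 - t)%:E * f y)%E.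

Definition strongly_convex_on (R : realType) (n : nat) (D : set 'rV[R]_n)
    (kappa : R) (f : 'rV[R]_n -> \bar R) : Prop :=
  [/\ 0 < kappa, convex_set D &
      econvex_on D (fun x => f x - (kappa / 2 * enorm x ^+ 2)%:E)%E].

Definition locally_strongly_convex (R : realType) (n : nat)
    (f : 'rV[R]_n -> \bar R) (x : 'rV[R]_n) : Prop :=
  exists (D : set 'rV[R]_n) (kappa : R),
    nbhs x D /\ strongly_convex_on D kappa f.

Definition variationally_strongly_convex (R : realType) (n : nat)
    (phi : 'rV[R]_n -> \bar R) (xbar vbar : 'rV[R]_n) (sigma : R) : Prop :=
  exists (U V : set 'rV[R]_n) (psi : 'rV[R]_n -> \bar R) (eps : R),
    let Ueps := [set x | U x /\ (phi x < phi xbar + eps%:E)%E] in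
    [/\ [/\ nbhs xbar U, convex_set U, nbhs vbar V & convex_set V],
        [/\ proper_fun psi, lower_semicontinuous psi,
            forall x, U x -> (psi x <= phi x)%E &
            strongly_convex_on U sigma psi],
        0 < eps,
        (Ueps `*` V) `&` gph (limiting_subdiff phi) =
        (U `*` V) `&` gph (limiting_subdiff psi) &
        forall x v,
          ((Ueps `*` V) `&` gph (limiting_subdiff phi)) (x, v) ->
          phi x = psi x].

Definition prox_regular (R : realType) (n : nat)
    (phi : 'rV[R]_n -> \bar R) (xbar vbar : 'rV[R]_n) : Prop :=
  exists (eps r : R), [/\ 0 < eps, 0 <= r &
    forall x u v : 'rV[R]_n,
      eball xbar eps x ->
      (gph (limiting_subdiff phi) `&` (eball xbar eps `*` eball vbar eps))
        (u, v) ->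
      (phi u < phi xbar + eps%:E)%E ->
      (phi u + (dotv v (x - u) - r / 2 * enorm (x - u) ^+ 2)%:E <= phi x)%E].

Definition moreau_env (R : realType) (n : nat) (lambda : R)
    (phi : 'rV[R]_n -> \bar R) (x : 'rV[R]_n) : \bar R :=
  ereal_inf (range (fun y : 'rV[R]_n =>
    phi y + ((2 * lambda)^-1 * enorm (y - x) ^+ 2)%:E)%E).

Definition prox_bounded (R : realType) (n : nat)
    (phi : 'rV[R]_n -> \bar R) : Prop :=
  exists (lambda : R) (x : 'rV[R]_n),
    0 < lambda /\ (-oo < moreau_env lambda phi x)%E.

(* Main.v *)
(* A global quadratic minorant of [phi], provided near [xbar] by either hypothesis
   and elsewhere by prox-boundedness, makes the proximal problem at [z] solvable for
   small [lambda], with every solution [y] close to [xbar] and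
   [lambda^-1 *: (z - y)] a subgradient at [y] close to [vbar], once [z] is close to
   [xbar + lambda *: vbar].

   (i) => (ii): such a pair lies in the graph of the subdifferential of [psi], so
   near [xbar + lambda *: vbar] the envelope is the infimal convolution of the
   strongly convex [psi] with a quadratic, whose modulus is
   [k * sigma / (k + sigma)] for [k = lambda^-1].

   (ii) => (i): by prox-regularity a nearby subgradient pair [(u, v)] satisfies
   [u = prox (u + lambda *: v)]. Convexity together with the upper quadratic bound
   coming from [u] makes [v] a strong subgradient of the envelope at
   [u + lambda *: v]; evaluating this at [x + lambda *: v] gives
   [phi x >= phi u + <v, x - u> + kappa / 2 * |x - u| ^ 2].
   Then [psi] is the supremum of these quadratics. Its subdifferential contains no
   other pair near [(xbar, vbar)], because it is monotone and the proximal map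
   produces a pair [(y, w)] with [y + lambda *: w = x + lambda *: v]. *)

Require Import Defs.
From mathcomp Require Import all_boot all_order all_algebra.
From mathcomp Require Import all_classical all_reals all_analysis.
From mathcomp Require Import ring lra.

Import Order.TTheory GRing.Theory Num.Theory.
Import numFieldNormedType.Exports.

Local Open Scope classical_set_scope.
Local Open Scope ring_scope.

Set Implicit Arguments.
Unset Strict Implicit.
Unset Printing Implicit Defensive.

(** * Euclidean inner product, norm and balls on row vectors *)

Section Euclidean.
Context {R : realType} {n : nat}.
Implicit Types (u v w x y z : 'rV[R]_n) (a t e : R).

Lemma dotvC u v : dotv u v = dotv v u.
Proof. by apply: eq_bigr => i _; rewrite mulrC. Qed.

Lemma dotvDl u v w : dotv (u + v) w = dotv u w + dotv v w.
Proof. by rewrite /dotv -big_split; apply: eq_bigr => i _; rewrite mxE mulrDl. Qed.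

Lemma dotvDr u v w : dotv w (u + v) = dotv w u + dotv w v.
Proof. by rewrite dotvC dotvDl !(dotvC _ w). Qed.

Lemma dotvZl a u v : dotv (a *: u) v = a * dotv u v.
Proof. by rewrite /dotv mulr_sumr; apply: eq_bigr => i _; rewrite mxE mulrA. Qed.

Lemma dotvZr a u v : dotv u (a *: v) = a * dotv u v.
Proof. by rewrite dotvC dotvZl dotvC. Qed.

Lemma dotv0l u : dotv 0 u = 0.
Proof. by rewrite -(scale0r 0) dotvZl mul0r. Qed.

Lemma dotv0r u : dotv u 0 = 0.
Proof. by rewrite dotvC dotv0l. Qed.

Lemma dotvNl u v : dotv (- u) v = - dotv u v.
Proof. by rewrite -scaleN1r dotvZl mulN1r. Qed.

Lemma dotvNr u v : dotv u (- v) = - dotv u v.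
Proof. by rewrite dotvC dotvNl dotvC. Qed.

Definition dotvE := (dotvDl, dotvDr, dotvNl, dotvNr, dotvZl, dotvZr).

Lemma dotvv_ge0 u : 0 <= dotv u u.
Proof. by apply: sumr_ge0 => i _; rewrite -expr2 sqr_ge0. Qed.

Lemma dotvv_eq0 u : dotv u u <= 0 -> u = 0.
Proof.
move=> u0; have /eqP : dotv u u = 0 by apply/le_anti; rewrite u0 dotvv_ge0.
rewrite psumr_eq0 => [/allP ui0|i _]; last by rewrite -expr2 sqr_ge0.
apply/rowP => i; have := ui0 i (mem_index_enum _).
by rewrite -expr2 sqrf_eq0 mxE => /eqP.
Qed.

Lemma enorm_sqr u : enorm u ^+ 2 = dotv u u.
Proof. by rewrite sqr_sqrtr// dotvv_ge0. Qed.

Lemma enorm_ge0 u : 0 <= enorm u.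
Proof. exact: sqrtr_ge0. Qed.

Lemma enorm0 : enorm (0 : 'rV[R]_n) = 0.
Proof. by rewrite /enorm dotv0l sqrtr0. Qed.

Lemma enorm_gt0 u : u != 0 -> 0 < enorm u.
Proof.
rewrite sqrtr_gt0 ltNge; apply: contraNN => u0.
by apply/eqP/dotvv_eq0.
Qed.

Lemma enorm_le u a : 0 <= a -> (enorm u <= a) = (dotv u u <= a ^+ 2).
Proof. by move=> a0; rewrite -enorm_sqr ler_sqr ?nnegrE ?enorm_ge0. Qed.

Lemma enormZ a u : enorm (a *: u) = `|a| * enorm u.
Proof. by rewrite /enorm dotvZl dotvZr mulrA -expr2 sqrtrM ?sqr_ge0// sqrtr_sqr. Qed.

(** Cauchy-Schwarz: for nonzero vectors, expand the square of [enorm v *: u - enorm u *: v] and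
    divide by the product of the norms. *)
Lemma dotv_le u v : dotv u v <= enorm u * enorm v.
Proof.
have [->|u0] := eqVneq u 0.
  by rewrite enorm0 mul0r dotv0l.
have [->|v0] := eqVneq v 0.
  by rewrite enorm0 mulr0 dotv0r.
have := dotvv_ge0 (enorm v *: u - enorm u *: v).
rewrite !dotvE -!enorm_sqr (dotvC v u).
have := enorm_gt0 u0; have := enorm_gt0 v0; move: (enorm u) (enorm v) => a b b0 a0 h.
have ab0 : 0 < a * b by rewrite mulr_gt0.
by rewrite -(ler_pM2l ab0); nra.
Qed.

Lemma enormD u v : enorm (u + v) <= enorm u + enorm v.
Proof.
rewrite enorm_le ?addr_ge0 ?enorm_ge0// !dotvE -!enorm_sqr (dotvC v u).
have := dotv_le u v; lra.
Qed.

(** Young's inequality, from the square of [2 * a *: u - v] divided by [4 * a]. *)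
Lemma dotv_young a u v : 0 < a -> dotv u v <= a * dotv u u + (4 * a)^-1 * dotv v v.
Proof.
move=> a0; have := dotvv_ge0 (2 * a *: u - v); rewrite !dotvE (dotvC v u) => h.
rewrite -(ler_pM2l (_ : 0 < 4 * a)); last lra.
rewrite mulrDr [X in _ + X]mulrA mulfV ?mul1r; last by apply: lt0r_neq0; lra.
lra.
Qed.

Lemma dotv_sqrD u v : dotv (u + v) (u + v) = dotv u u + 2 * dotv u v + dotv v v.
Proof. by rewrite !dotvE (dotvC v u); ring. Qed.

Lemma dotv_sqrB u v : dotv (u - v) (u - v) = dotv u u - 2 * dotv u v + dotv v v.
Proof. by rewrite !dotvE (dotvC v u); ring. Qed.

(** This exact defect translates between convexity of [f - kappa / 2 * |.|^2] and the inequality for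
    [f] with a [t * (1 - t)] term. *)
Lemma dotv_conv t u v :
  dotv (t *: u + (1 - t) *: v) (t *: u + (1 - t) *: v) =
  t * dotv u u + (1 - t) * dotv v v - t * (1 - t) * dotv (u - v) (u - v).
Proof. by rewrite !dotvE (dotvC v u); ring. Qed.

Lemma mx_norm_le_enorm u : `|u| <= enorm u.
Proof.
rewrite [`|u|]mx_normrE; apply/bigmax_leP; split; first exact: enorm_ge0.
move=> [i j] _ /=; rewrite -ler_sqr ?nnegrE ?enorm_ge0// enorm_sqr ord1.
rewrite real_normK ?num_real// /dotv (bigD1 j)//= -expr2 lerDl.
by apply: sumr_ge0 => k _; rewrite -expr2 sqr_ge0.
Qed.

(** The factor [n.+1] is crude, but it is positive even for [n = 0], so radii can be divided by
    it. *)
Lemma enorm_le_mx_norm u : enorm u <= n.+1%:R * `|u|.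
Proof.
rewrite enorm_le ?mulr_ge0//.
have h : dotv u u <= \sum_(i < n) `|u| ^+ 2.
  apply: ler_sum => i _; rewrite -expr2 -[leLHS]real_normK ?num_real//.
  rewrite ler_sqr ?nnegrE// [`|u|]mx_normrE.
  by rewrite (le_bigmax _ (fun ij : 'I_1 * 'I_n => `|u ij.1 ij.2|) (ord0, i)).
apply: (le_trans h); rewrite sumr_const card_ord exprMn -[leLHS]mulr_natl.
apply: ler_wpM2r; first exact: sqr_ge0.
by rewrite -natrX ler_nat (leq_trans (leqnSn _))// leq_pmulr.
Qed.

Lemma eball_nbhs x e : 0 < e -> nbhs x (eball x e).
Proof.
move=> e0; rewrite -nbhs_nbhs_norm; exists (e / n.+1%:R) => /=; first by rewrite divr_gt0.
move=> y /=; rewrite /eball /= ltr_pdivlMr// distrC => /ltW h.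
by apply: le_trans (enorm_le_mx_norm _) _; rewrite mulrC.
Qed.

Lemma nbhs_eballP x (A : set 'rV[R]_n) :
  nbhs x A <-> exists2 e, 0 < e & eball x e `<=` A.
Proof.
split=> [|[e e0 eA]]; last exact: filterS eA (eball_nbhs _ e0).
rewrite -nbhs_nbhs_norm => -[e /= e0 eA].
exists (e / 2); first lra.
move=> y; rewrite /eball /= => yx; apply: eA => /=; rewrite distrC.
by apply: le_lt_trans (mx_norm_le_enorm _) _; lra.
Qed.

Lemma eball_center x e : 0 <= e -> eball x e x.
Proof. by rewrite /eball /= subrr enorm0. Qed.

Lemma sub_eball x a e : a <= e -> eball x a `<=` eball x e.
Proof. by move=> ae y; rewrite /eball /= => /le_trans; exact. Qed.

Lemma eball_conv x y z e t : 0 <= t <= 1 -> eball x e y -> eball x e z ->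
  eball x e (t *: y + (1 - t) *: z).
Proof.
rewrite /eball /= => /andP[t0 t1] yx zx.
have -> : t *: y + (1 - t) *: z - x = t *: (y - x) + (1 - t) *: (z - x).
  rewrite !scalerBr addrACA -opprD -scalerDl [t + _]addrC subrK scale1r//.
have e0 : 0 <= e := le_trans (enorm_ge0 _) yx.
apply: le_trans (enormD _ _) _; rewrite !enormZ !ger0_norm ?subr_ge0//.
move: (enorm _) (enorm _) yx zx => a b; nra.
Qed.

Lemma eball_convex x e : convex_set (eball x e : set (convex_lmodType 'rV[R]_n)).
Proof.
move=> y z t; rewrite !inE => yx zx.
by apply: eball_conv => //; rewrite ge0 le1.
Qed.

Lemma cvg_dotv (T : Type) (F : set_system T) {FF : Filter F}
    (f g : T -> 'rV[R]_n) u v :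
  f @ F --> u -> g @ F --> v -> (fun s => dotv (f s) (g s)) @ F --> dotv u v.
Proof.
have coord (h : T -> 'rV[R]_n) (w : 'rV[R]_n) (j : 'I_n) :
    h @ F --> w -> (fun s => h s ord0 j) @ F --> w ord0 j.
  by move=> hw A /(@coord_continuous R 1 n ord0 j w) /hw.
move=> fu gv; rewrite /dotv; apply: cvg_big; first exact: add_continuous.
by move=> i _; apply: cvgM; exact: coord.
Qed.

End Euclidean.

(** * Regular and limiting subgradients, and their growth under strong convexity *)

Section Subdifferential.
Context {R : realType} {n : nat}.
Implicit Types (f : 'rV[R]_n -> \bar R) (u v w x y z : 'rV[R]_n) (a b t e : R).

Lemma edom_EFin f x : (forall y, f y != -oo%E) -> edom f x ->
  exists a, f x = a%:E.
Proof.
rewrite /edom /= => /(_ x); case: (f x) => [a _ _|//|//].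
by exists a.
Qed.

Lemma quotient_ge (X : \bar R) a p r e : 0 < r ->
  ((- e)%:E <= (X - a%:E - p%:E) * r^-1%:E)%E = ((a + (p - e * r))%:E <= X)%E.
Proof.
move=> r0; case: X => [b| |].
- rewrite -!EFinB -EFinM !lee_fin -(ler_pM2r r0) mulfVK ?gt_eqF//.
  by rewrite [LHS](_ : _ = (a + (p - e * r) <= b)); last (apply/idP/idP; lra).
- by rewrite gt0_mulye ?lte_fin ?invr_gt0// !leey.
- by rewrite !addNye gt0_mulNye ?lte_fin ?invr_gt0.
Qed.

(** The lower limit is a supremum, over punctured neighbourhoods, of infima of the quotient, and
    [quotient_ge] clears the denominator. At [y = x] the inequality is trivial, so full
    neighbourhoods can be used. *)
Lemma regular_subdiffP f x v : (forall y, f y != -oo%E) ->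
  regular_subdiff f x v <-> edom f x /\ forall e, 0 < e ->
    \forall y \near x, (f x + (dotv v (y - x) - e * enorm (y - x))%:E <= f y)%E.
Proof.
move=> fNy; rewrite /regular_subdiff /= limf_einfE.
split=> -[xf fx]; split=> //; have [a fa] := edom_EFin fNy xf; rewrite fa in fx *.
- move=> e e0.
  have : ((- e)%:E < 0 :> \bar R)%E by rewrite lte_fin oppr_lt0.
  move=> /lt_le_trans/(_ fx)/ereal_sup_gt[_ [V Vx <-] eV].
  have {}Vx : \forall y \near x, y != x -> V y by exact: Vx.
  apply: filterS Vx => y; have [->|yx] := eqVneq y x => [_|/(_ isT) Vy].
    by rewrite subrr enorm0 mulr0 subr0 dotv0r adde0 fa.
  rewrite -EFinD -quotient_ge; last by rewrite enorm_gt0// subr_eq0.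
  by apply: (le_trans (ltW eV)); apply: ereal_inf_lbound; exists y.
- apply/lee_addgt0Pr => e e0; rewrite -leeBlDr// sub0e.
  set V := [set y | (a%:E + (dotv v (y - x) - e * enorm (y - x))%:E <= f y)%E
                    /\ y != x].
  have Vx : x^' V.
    by apply: (@filterS _ (nbhs x)) (fx _ e0) => y.
  apply: le_trans (ereal_sup_ubound _); last by exists V.
  apply: le_ereal_inf_tmp => _ [y [fy yx] <-].
  by rewrite quotient_ge// enorm_gt0// subr_eq0.
Qed.

(** Within radius [e / (|c| + 1)] the quadratic error is at most [e * |y - x|]. *)
Lemma regular_subdiff_quadratic f x v c : (forall y, f y != -oo%E) -> edom f x ->
  (\forall y \near x,
     (f x + (dotv v (y - x) - c * dotv (y - x) (y - x))%:E <= f y)%E) ->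
  regular_subdiff f x v.
Proof.
move=> fNy xf fx; apply/regular_subdiffP => //; split=> // e e0.
have d0 : 0 < e / (`|c| + 1) by rewrite divr_gt0// ltr_wpDl.
have := eball_nbhs x d0; apply: filterS2 fx => y fy.
rewrite /eball /= ler_pdivlMr ?ltr_wpDl// => ye.
apply: le_trans fy; rewrite leeD2l// lee_fin lerD2l lerN2 -enorm_sqr.
have := enorm_ge0 (y - x); have := ler_norm c; move: (enorm _) ye => r; nra.
Qed.

Lemma regular_limiting_subdiff f x v :
  regular_subdiff f x v -> limiting_subdiff f x v.
Proof.
move=> fxv; split; first exact: fxv.1.
by exists (fun=> x), (fun=> v); split=> //; exact: cvg_cst.
Qed.

Lemma strongly_convex_le f (U : set 'rV[R]_n) kappa x y t a b :
  strongly_convex_on U kappa f -> U x -> U y -> 0 <= t <= 1 ->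
  f x = a%:E -> f y = b%:E ->
  (f (t *: x + (1 - t) *: y)%R
   <= (t * a + (1 - t) * b
       - kappa / 2 * t * (1 - t) * dotv (x - y) (x - y))%:E)%E.
Proof.
move=> [_ _ cf] Ux Uy t01 fx fy; have := cf x y t Ux Uy t01.
rewrite fx fy -!EFinB -!EFinM -EFinD leeBlDr// -EFinD => /le_trans; apply.
by rewrite lee_fin !enorm_sqr dotv_conv; lra.
Qed.

(** Strong convexity bounds [f] from above on the segment from [x] to [y], the subgradient bounds it
    from below near [x]. Comparing both at [x + t *: (y - x)] and dividing by a small [t] gives the
    claim up to an arbitrary [e]. *)
Lemma regular_subdiff_strongly_convex f (U : set 'rV[R]_n) kappa x v y :
  (forall y, f y != -oo%E) -> strongly_convex_on U kappa f ->
  U x -> regular_subdiff f x v -> U y ->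
  (f x + (dotv v (y - x) + kappa / 2 * dotv (y - x) (y - x))%:E <= f y)%E.
Proof.
move=> fNy cf Ux /(regular_subdiffP _ _ fNy)[xf fx] Uy.
have [a fa] := edom_EFin fNy xf.
case fyE : (f y) => [b| |]; [|by rewrite leey|by have := fNy y; rewrite fyE].
have [k0 _ _] := cf.
rewrite fa -EFinD lee_fin; apply/ler_addgt0Pr => e e0.
set d := y - x; set r := enorm d; set D := dotv d d.
have r0 : 0 <= r by exact: enorm_ge0.
have D0 : 0 <= D by exact: dotvv_ge0.
set e' := e / (2 * (r + 1)).
have e'0 : 0 < e' by rewrite divr_gt0// mulr_gt0// ltr_wpDl.
have e're : e' * r <= e / 2.
  rewrite /e' invfM mulrA mulrAC ler_pdivrMr ?ltr_wpDl//; nra.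
have [s s0 xs] := (nbhs_eballP _ _).1 (fx _ e'0).
(* The bound with [s] keeps [x + t *: d] in the ball where the subgradient estimate holds; the last
   one makes the loss [kappa / 2 * t * D] at most [e / 2], the other half of [e] paying for
   [e' * r]. *)
set t := Num.min 1 (Num.min (s / (r + 1)) (e / (kappa * D + 1))).
have kD0 : 0 < kappa * D + 1 by rewrite ltr_wpDl// mulr_ge0// ltW.
have t0 : 0 < t by rewrite !lt_min ltr01/= !divr_gt0// ltr_wpDl.
have t1 : t <= 1 by rewrite ge_min lexx.
have ts : t * (r + 1) <= s.
  by rewrite -ler_pdivlMr ?ltr_wpDl// !ge_min lexx !orbT.
have te : t * (kappa * D + 1) <= e.
  by rewrite -ler_pdivlMr// !ge_min lexx !orbT.
have := strongly_convex_le cf Uy Ux _ fyE fa => /(_ t).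
have ydE : t *: y + (1 - t) *: x - x = t *: d.
  by apply/rowP => i; rewrite !mxE; ring.
(* By contraposition: if the claim failed, the upper bound from convexity would lie strictly below
   the lower bound from the subgradient. *)
rewrite (ltW t0) t1 => /(_ isT); apply: contraTT; rewrite -!ltNge => bea.
apply: lt_le_trans (xs _ _); last first.
  by rewrite /eball /= ydE enormZ gtr0_norm// -/r; nra.
rewrite ydE dotvZr enormZ gtr0_norm// -/r fa -EFinD lte_fin -/d -/D.
set p := dotv v d in bea *.
have h1 : kappa / 2 * t * D <= e / 2 by nra.
rewrite -subr_gt0.
have -> : a + (t * p - e' * (t * r)) -
  (t * b + (1 - t) * a - kappa / 2 * t * (1 - t) * D) =
  t * (a + (p + kappa / 2 * D) - b - e' * r - kappa / 2 * t * D) by field.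
by rewrite mulr_gt0//; lra.
Qed.

(** For fixed [y] the inequality for regular subgradients passes to the limit along the defining
    sequence, whose points eventually lie in [U]. *)
Lemma limiting_subdiff_strongly_convex f (U : set 'rV[R]_n) kappa x v y :
  (forall y, f y != -oo%E) -> strongly_convex_on U kappa f ->
  nbhs x U -> limiting_subdiff f x v -> U y ->
  (f x + (dotv v (y - x) + kappa / 2 * dotv (y - x) (y - x))%:E <= f y)%E.
Proof.
move=> fNy cf Ux [xf [xk [vk [xkx fxk vkxk vkv]]]] Uy.
have yxk : (fun k => y - xk k) @ \oo --> y - x by apply: cvgB => //; exact: cvg_cst.
have lim : (f (xk k) + (dotv (vk k) (y - xk k) +
     kappa / 2 * dotv (y - xk k) (y - xk k))%:E)%E @[k --> \oo] -->
   (f x + (dotv v (y - x) + kappa / 2 * dotv (y - x) (y - x))%:E)%E.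
  apply: cvgeD => //; first by rewrite fin_num_adde_defl.
  apply: cvg_EFin; first by near=> k.
  apply: cvgD; first exact: cvg_dotv.
  by apply: cvgM; [exact: cvg_cst|exact: cvg_dotv].
have xkU : \forall k \near \oo, U (xk k) by exact: xkx _ Ux.
apply: (cvge_le _ lim); apply: filterS xkU => k Uk.
exact: regular_subdiff_strongly_convex cf Uk (vkxk k) Uy.
Unshelve. all: by end_near. Qed.

End Subdifferential.

(** * Lower semicontinuous functions: minima on compact sets and continuous perturbations *)

Section LowerSemicontinuous.
Context {R : realType}.

(** If the infimum [m] is not attained, the sets of points of [A] with [F < a], for [a > m],
    generate a proper filter. At a cluster point [y], take [a] strictly between [m] and [F y]: lower
    semicontinuity gives a neighbourhood of [y] where [F > a], yet it meets the set where
    [F < a]. *)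
Lemma lsc_compact_min (T : topologicalType) (F : T -> \bar R) (A : set T) :
  lower_semicontinuous F -> compact A -> A !=set0 ->
  exists2 y, A y & forall x, A x -> (F y <= F x)%E.
Proof.
move=> lscF cA [x0 Ax0]; set m := ereal_inf (F @` A).
have [[y Ay ym]|noy] := pselect (exists2 y, A y & (F y <= m)%E).
  by exists y => // x Ax; apply: le_trans ym _; apply: ereal_inf_lbound; exists x.
have Am y : A y -> (m < F y)%E.
  by move=> Ay; rewrite ltNge; apply/negP => Fym; apply: noy; exists y.
have mub a : (m < a%:E)%E -> exists2 y, A y & (F y < a%:E)%E.
  by move=> /ereal_inf_lt[_ [y Ay <-]]; exists y.
pose B a := [set y | A y /\ (F y < a%:E)%E].
have [a0 ma0] : exists a, (m < a%:E)%E.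
  move: (Am _ Ax0); case: (m) => [c| |]; last by exists 0; rewrite ltNyr.
    by exists (c + 1); rewrite lte_fin ltrDl.
  by case: (F x0).
pose G := filter_from [set a | (m < a%:E)%E] B.
have GF : ProperFilter G.
  apply: filter_from_proper; last by move=> a /mub[y Ay Fy]; exists y.
  apply: filter_from_filter; first by exists a0.
  move=> a b ma mb; exists (Num.min a b).
    by rewrite /= EFin_min lt_min ma mb.
  by move=> y [Ay]; rewrite EFin_min lt_min => /andP[Fa Fb].
have GA : G A by exists a0 => // y [].
have [y [Ay yG]] := cA G GF GA.
have [a ma aF] : exists2 a, (m < a%:E)%E & (a%:E < F y)%E.
  move: (Am _ Ay) ma0; case: (m) => [c| |]; case: (F y) => [b| |] //.
  - rewrite lte_fin => cb _; exists ((c + b) / 2); rewrite lte_fin; lra.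
  - by move=> _ _; exists (c + 1); rewrite ?ltry// lte_fin ltrDl.
  - by move=> _ _; exists (b - 1); rewrite ?ltNyr// lte_fin ltrBlDr ltrDl.
  - by move=> _ _; exists 0; rewrite ?ltNyr ?ltry.
have [V Vy aV] := lscF _ _ aF.
have [x [[_ Fx] Vx]] := yG (B a) V (ex_intro2 _ _ a ma (@subset_refl _ _)) Vy.
by have := lt_trans (aV _ Vx) Fx; rewrite ltxx.
Qed.

Lemma lscD_continuous (T : topologicalType) (F : T -> \bar R) (g : T -> R) :
  lower_semicontinuous F -> (forall x, g @ x --> g x) ->
  lower_semicontinuous (fun x => F x + (g x)%:E)%E.
Proof.
move=> lscF cg x a aF.
(* [c] splits the margin between the summands: near [x], both [F > c] and [g > a - c]. *)
have [c ac cF] : exists2 c, a - g x < c & (c%:E < F x)%E.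
  move: aF; case: (F x) => [b| |] // aF.
    move: aF; rewrite -EFinD lte_fin => aF.
    exists ((b + a - g x) / 2); rewrite ?lte_fin; lra.
  by exists (a - g x + 1); rewrite ?ltrDl// ltry.
have [V Vx cV] := lscF _ _ cF.
have gx : nbhs x [set y | a - c < g y].
  by apply: (cvgr_gt (g x)) => //; [exact: cg|lra].
exists (V `&` [set y | a - c < g y]); first exact: filterI.
move=> y [/cV cFy /= gy]; case: (F y) cFy => [b| _|//]; last by rewrite addye ?ltry.
by rewrite -EFinD !lte_fin => cb; lra.
Qed.

End LowerSemicontinuous.

(** * Proximal points and the Moreau envelope *)

Section Proximal.
Context {R : realType} {n : nat}.
Implicit Types (phi : 'rV[R]_n -> \bar R) (u v w x y z : 'rV[R]_n) (a b t e : R).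

Lemma cvg_subr x y : z - x @[z --> y] --> y - x.
Proof. by apply: (@cvgB _ _ _ (nbhs y)); [exact: cvg_id|exact: cvg_cst]. Qed.

Lemma eball_compact x e : compact (eball x e).
Proof.
apply: bounded_closed_compact.
  exists (`|x| + e); split; first exact: num_real.
  move=> M eM y; rewrite /eball /= => yx.
  have := mx_norm_le_enorm (y - x); have := lerB_dist y x; lra.
have [e0|e0] := leP 0 e; last first.
  rewrite (_ : eball x e = set0); first exact: closed0.
  apply/seteqP; split => // y; rewrite /eball /= => /le_lt_trans/(_ e0).
  by rewrite ltNge enorm_ge0.
rewrite (_ : eball x e =
  (fun y => dotv (y - x) (y - x)) @^-1` [set t | t <= e ^+ 2]); last first.
  by apply/seteqP; split => y; rewrite /eball /= enorm_le.
apply: preimage_closed; last exact: closed_le.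
by move=> y _; apply: (cvg_dotv (@cvg_subr x y) (@cvg_subr x y)).
Qed.

Definition prox_obj (lambda : R) phi z y : \bar R :=
  (phi y + ((2 * lambda)^-1 * enorm (y - z) ^+ 2)%:E)%E.

Definition is_prox (lambda : R) phi z y : Prop :=
  forall y', (prox_obj lambda phi z y <= prox_obj lambda phi z y')%E.

Lemma moreau_env_prox lambda phi z y : is_prox lambda phi z y ->
  moreau_env lambda phi z = prox_obj lambda phi z y.
Proof.
move=> zy; apply/le_anti/andP; split; first by apply: ereal_inf_lbound; exists y.
by apply: le_ereal_inf_tmp => _ [y' _ <-]; exact: zy.
Qed.

(** Expanding the squares in the minimality of [y] leaves a linear lower bound with error
    [(2 * lambda)^-1 * |x - y|^2], which suffices for a regular subgradient. *)
Lemma prox_regular_subdiff lambda phi z y : (forall y, phi y != -oo%E) ->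
  0 < lambda -> edom phi y -> is_prox lambda phi z y ->
  regular_subdiff phi y (lambda^-1 *: (z - y)).
Proof.
move=> phiNy l0 yphi zy; have [a phiy] := edom_EFin phiNy yphi.
apply: (@regular_subdiff_quadratic _ _ _ _ _ (2 * lambda)^-1) => //.
apply: filterE => x; have := zy x; rewrite /prox_obj phiy.
case: (phi x) (phiNy x) => [b _| _|//]; last by rewrite addye ?leey.
rewrite -!EFinD !lee_fin !enorm_sqr.
have -> : x - z = (x - y) - (z - y) by rewrite opprB addrA subrK.
have -> : y - z = - (z - y) by rewrite opprB.
move: (x - y) (z - y) => d w; rewrite !dotvE (dotvC w d).
have -> : (2 * lambda)^-1 = lambda^-1 / 2 by rewrite invfM mulrC.
lra.
Qed.

(** * The proximal problem under a global quadratic minorant *)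

Section Minorant.
Context (phi : 'rV[R]_n -> \bar R) (xbar vbar : 'rV[R]_n) (f0 r lambda : R)
  (phiNy : forall y, phi y != -oo%E) (phixbar : phi xbar = f0%:E)
  (l0 : 0 < lambda) (lr : lambda * r <= 1 / 2)
  (minorant : forall y, ((f0 + (dotv vbar (y - xbar)
     - r / 2 * dotv (y - xbar) (y - xbar)))%:E <= phi y)%E).

Let zbar := xbar + lambda *: vbar.

(** Put [d = y - xbar] and [w = z - zbar]. Comparing with [xbar] and inserting the minorant gives
    [|d|^2 <= 4 <d, w>], since [lambda * r <= 1 / 2]; Young's inequality with weight [1 / 8] then
    gives [|d|^2 <= 16 |w|^2]. As [y] need not be a minimizer, the estimate serves for existence as
    well as for location. *)
Lemma prox_obj_estimate z y :
  (prox_obj lambda phi z y <= prox_obj lambda phi z xbar)%E ->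
  enorm (y - xbar) <= 4 * enorm (z - zbar) /\
  (phi y <= (f0 + dotv vbar (y - xbar)
             + lambda^-1 * dotv (y - xbar) (z - zbar))%:E)%E.
Proof.
rewrite /prox_obj phixbar; have := minorant y.
case: (phi y) (phiNy y) => [b _| _|//]; last by [].
rewrite -!EFinD !lee_fin !enorm_sqr enorm_le ?mulr_ge0 ?enorm_ge0// exprMn enorm_sqr.
have -> : y - z = (y - xbar) - (z - zbar) - lambda *: vbar.
  by rewrite /zbar; apply/rowP => i; rewrite !mxE; ring.
have -> : xbar - z = - (z - zbar) - lambda *: vbar.
  by rewrite /zbar; apply/rowP => i; rewrite !mxE; ring.
move: (y - xbar) (z - zbar) => d w; rewrite !dotvE.
rewrite (dotvC vbar d) (dotvC vbar w) (dotvC w d).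
have := dotvv_ge0 d; have := dotvv_ge0 w.
have := @dotv_young _ _ (1 / 8) d w ltac:(lra).
have -> : (4 * (1 / 8))^-1 = 2 :> R by field.
move: (dotv d d) (dotv w w) (dotv d w) (dotv d vbar) (dotv w vbar)
  (dotv vbar vbar) => D W dw dv wv vv young W0 D0 bmin.
have -> : (2 * lambda)^-1 = lambda^-1 / 2 by rewrite invfM mulrC.
have lV : lambda * lambda^-1 = 1 by rewrite mulfV// gt_eqF.
have : 0 < lambda^-1 by rewrite invr_gt0.
move: (lambda^-1) lV => k lV k0 h.
have lkx (c : R) : lambda * (k * c) = c by rewrite mulrA lV mul1r.
have kb : b <= f0 + dv + k * dw - k / 2 * D by have := lkx dv; lra.
split; last by nra.
have h1 : k / 2 * D - r / 2 * D <= k * dw by lra.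
have h2 : D - (lambda * r) * D <= 2 * dw.
  have : lambda * (k / 2 * D - r / 2 * D) <= lambda * (k * dw) by rewrite ler_pM2l.
  rewrite lkx mulrBr -mulrA lkx; lra.
have : 0 <= (1 / 2 - lambda * r) * D by rewrite mulr_ge0// subr_ge0.
lra.
Qed.

Lemma prox_dom z y : is_prox lambda phi z y -> edom phi y.
Proof.
move=> /(_ xbar); rewrite /prox_obj phixbar /edom /=.
by case: (phi y) => [b _|//|_]; rewrite ?ltry.
Qed.

(** By the estimate, every point doing at least as well as [xbar] lies in one compact ball around
    [xbar], so a minimizer over that ball is global. *)
Lemma prox_exists z : lower_semicontinuous phi -> exists y, is_prox lambda phi z y.
Proof.
move=> lsc_phi.
have lsc_obj : lower_semicontinuous (prox_obj lambda phi z).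
  apply: lscD_continuous => // y.
  rewrite [X in X @ _](_ : _ = (fun y => (2 * lambda)^-1 * dotv (y - z) (y - z))).
    rewrite enorm_sqr.
    exact: (cvgM (cvg_cst _) (cvg_dotv (@cvg_subr z y) (@cvg_subr z y))).
  by apply/funext => x; rewrite enorm_sqr.
have Axbar : eball xbar (4 * enorm (z - zbar)) xbar.
  by apply: eball_center; rewrite mulr_ge0// enorm_ge0.
have [y Ay ymin] := lsc_compact_min lsc_obj (@eball_compact xbar _)
  (ex_intro _ _ Axbar).
exists y => y'; have [/prox_obj_estimate[y'A _]|/ltW] :=
  leP (prox_obj lambda phi z y') (prox_obj lambda phi z xbar); first exact: ymin.
by apply: le_trans; exact: ymin.
Qed.

Lemma prox_close e : 0 < e -> exists2 d, 0 < d &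
  forall z y, eball zbar d z -> is_prox lambda phi z y ->
  [/\ eball xbar e y, eball vbar e (lambda^-1 *: (z - y)) & (phi y < (f0 + e)%:E)%E].
Proof.
move=> e0; set N := enorm vbar + 1.
have N0 : 0 < N by rewrite ltr_wpDl// enorm_ge0.
(* Since [|y - xbar| <= 4 * d], the first entry bounds the distance of [y] and the second the
   distance of the subgradient, through [|z - zbar| + |y - xbar| <= 5 * d]. With [d <= lambda] the
   excess of [phi y] over [f0] is at most [N * |y - xbar|], which the last entry keeps below [e]. *)
set d := Num.min (Num.min (e / 4) (lambda * e / 5)) (Num.min lambda (e / (8 * N))).
have d0 : 0 < d by rewrite !lt_min l0 !divr_gt0 ?mulr_gt0.
have d1 : d <= e / 4 by rewrite !ge_min lexx.
have d2 : d <= lambda * e / 5 by rewrite !ge_min lexx !orbT.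
have d3 : d <= lambda by rewrite !ge_min lexx !orbT.
have d4 : d * (8 * N) <= e by rewrite -ler_pdivlMr ?mulr_gt0// !ge_min lexx !orbT.
exists d => // z y; rewrite /eball /= => zd /(_ xbar)/prox_obj_estimate[yx phiy].
have lV : lambda * lambda^-1 = 1 by rewrite mulfV// gt_eqF.
have k0 : 0 < lambda^-1 by rewrite invr_gt0.
split; first lra.
- have -> : lambda^-1 *: (z - y) - vbar = lambda^-1 *: ((z - zbar) + (-1) *: (y - xbar)).
    apply/rowP => i; rewrite !mxE.
    by field; rewrite gt_eqF.
  rewrite enormZ gtr0_norm// ler_pdivrMl//; apply: le_trans (enormD _ _) _.
  rewrite enormZ normrN1; lra.
- apply: le_lt_trans phiy _; rewrite lte_fin.
  have := dotv_le vbar (y - xbar); have := dotv_le (y - xbar) (z - zbar).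
  have := enorm_ge0 vbar; have := enorm_ge0 (y - xbar); have := enorm_ge0 (z - zbar).
  rewrite /N in d4 N0.
  move: (enorm vbar) (enorm (y - xbar)) (enorm (z - zbar)) (dotv _ _) (dotv _ _)
    yx zd N0 d4 => V D W a b yx zd N0 d4 W0 D0 V0 bD aV.
  have kW : lambda^-1 * b <= D.
    by rewrite ler_pdivrMl//; nra.
  nra.
Qed.

End Minorant.

(** Prox-boundedness gives a quadratic minorant with another centre [x1]. Outside the ball of radius
    [e0] a constant is dominated by a multiple of [|y - xbar|^2], so enough curvature puts the
    desired quadratic below that minorant. *)
Lemma global_minorant phi xbar vbar (f0 r0 e0 : R) : (forall y, phi y != -oo%E) ->
  prox_bounded phi -> 0 < e0 -> 0 <= r0 ->
  (forall y, eball xbar e0 y -> ((f0 + (dotv vbar (y - xbar)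
     - r0 / 2 * dotv (y - xbar) (y - xbar)))%:E <= phi y)%E) ->
  exists2 r, 0 <= r & forall y, ((f0 + (dotv vbar (y - xbar)
     - r / 2 * dotv (y - xbar) (y - xbar)))%:E <= phi y)%E.
Proof.
move=> phiNy [l [x1 [l0 bnd]]] e0_gt0 r00 loc.
have [c cphi] : exists c, forall y,
    ((c - (2 * l)^-1 * dotv (y - x1) (y - x1))%:E <= phi y)%E.
  have [c cm] : exists c, (c%:E <= moreau_env l phi x1)%E.
    by case: (moreau_env l phi x1) bnd => [c _|_|//]; [exists c|exists 0; rewrite leey].
  exists c => y; have : (c%:E <= phi y + ((2 * l)^-1 * enorm (y - x1) ^+ 2)%:E)%E.
    by apply: (le_trans cm); apply: ereal_inf_lbound; exists y.
  by rewrite enorm_sqr EFinB leeBlDr.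
set a := xbar - x1.
(* [K] collects the constants left by recentring at [xbar] and by Young's inequality. The three
   terms of [s] absorb, in order, these constants, the recentred quadratic and the linear term in
   [vbar]. *)
set K := `|f0 - c + l^-1 * dotv a a + dotv vbar vbar|.
set s := 2 * (K / e0 ^+ 2 + l^-1 + 1 / 4).
have k0 : 0 < l^-1 by rewrite invr_gt0.
exists (Num.max r0 s) => [|y]; first by apply: (le_trans r00); rewrite le_max lexx.
set m := Num.max r0 s.
have mr0 : r0 <= m by rewrite le_max lexx.
have ms : s <= m by rewrite le_max lexx orbT.
have := dotvv_ge0 (y - xbar); set D := dotv _ _ => D0.
have [yx|yx] := leP (enorm (y - xbar)) e0.
  apply: le_trans (loc _ yx); rewrite lee_fin -/D; nra.
apply: le_trans (cphi y); rewrite lee_fin.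
have -> : y - x1 = (y - xbar) + a by rewrite /a addrA subrK.
have De0 : e0 ^+ 2 <= D by rewrite /D -enorm_sqr ler_sqr ?nnegrE ?enorm_ge0 ?ltW.
have KD : K <= K / e0 ^+ 2 * D.
  by rewrite mulrAC ler_pdivlMr ?exprn_gt0// ler_wpM2l// normr_ge0.
have := @dotv_young _ _ (1 / 4) (y - xbar) vbar ltac:(lra).
have -> : (4 * (1 / 4))^-1 = 1 :> R by field.
have := dotvv_ge0 ((y - xbar) - a).
rewrite (dotv_sqrB (y - xbar) a) (dotv_sqrD (y - xbar) a) -/D => sq.
rewrite (dotvC _ vbar) => young.
have -> : (2 * l)^-1 = l^-1 / 2 by rewrite invfM mulrC.
have := ler_norm (f0 - c + l^-1 * dotv a a + dotv vbar vbar); rewrite -/K => Kn.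
have sD : s / 2 * D <= m / 2 * D by nra.
have sE : s / 2 * D = K / e0 ^+ 2 * D + l^-1 * D + 1 / 4 * D.
  by rewrite /s; move: (K / e0 ^+ 2) (l^-1) => p q; field.
have := ler_wpM2l (ltW k0) sq; rewrite mulr0 => ksq.
lra.
Qed.

End Proximal.

(** * Strong subgradients and strong convexity of the Moreau envelope *)

Section MoreauConvexity.
Context {R : realType} {n : nat}.
Implicit Types (phi psi : 'rV[R]_n -> \bar R) (u v w x y z : 'rV[R]_n).
Implicit Types (a b t lambda kappa sigma : R).

Lemma moreau_env_subgradient phi lambda (e : 'rV[R]_n -> R) (D : set 'rV[R]_n) kappa
    z z' y a : 0 < lambda ->
  (forall w, moreau_env lambda phi w = (e w)%:E) ->
  strongly_convex_on D kappa (moreau_env lambda phi) ->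
  nbhs z D -> D z' -> is_prox lambda phi z y -> phi y = a%:E ->
  e z + dotv (lambda^-1 *: (z - y)) (z' - z)
    + kappa / 2 * dotv (z' - z) (z' - z) <= e z'.
Proof.
move=> l0 eE cD Dz Dz' zy phiy.
(* Using [y] as a competitor at every [w] gives a quadratic upper bound on the envelope, with
   equality at [z]. *)
have ub w : e w <= a + (2 * lambda)^-1 * dotv (y - w) (y - w).
  rewrite -lee_fin -eE EFinD -phiy -enorm_sqr.
  by apply: ereal_inf_lbound; exists y.
have ez : e z = a + (2 * lambda)^-1 * dotv (y - z) (y - z).
  by apply: EFin_inj; rewrite -eE (moreau_env_prox zy) /prox_obj phiy enorm_sqr.
have [k0 _ _] := cD.
have l20 : 0 < (2 * lambda)^-1 by rewrite invr_gt0 mulr_gt0.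
set h := z' - z; have h0 := dotvv_ge0 h.
have [d d0 zd] := (nbhs_eballP _ _).1 Dz.
apply/ler_addgt0Pr => eta eta0.
set H := dotv h h in h0 *; set g := dotv (lambda^-1 *: (z - y)) h.
set r := enorm h; have r0 : 0 <= r by exact: enorm_ge0.
have c0 : 0 < (2 * lambda)^-1 * H + 1 by rewrite ltr_wpDl// mulr_ge0// ltW.
(* The first entry keeps [z - t *: h] in [D]; the second bounds the quadratic remainder, after
   division by [t], by [eta]. *)
set t := Num.min (d / (r + 1)) (eta / ((2 * lambda)^-1 * H + 1)).
have t0 : 0 < t by rewrite lt_min !divr_gt0// ltr_wpDl.
have td : t * (r + 1) <= d by rewrite -ler_pdivlMr ?ltr_wpDl// !ge_min lexx.
have te : t * ((2 * lambda)^-1 * H + 1) <= eta.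
  by rewrite -ler_pdivlMr// !ge_min lexx !orbT.
(* Convexity along the ray from [z' = z + h] through [z] to [z - t *: h], where
   [e] is bounded above, turns this upper bound into a lower bound at [z']. *)
have Dzt : D (z - t *: h).
  apply: zd; rewrite /eball /= addrAC subrr sub0r -scaleNr enormZ normrN gtr0_norm//.
  by rewrite -/r; nra.
set s := (1 + t)^-1.
have t10 : 0 < 1 + t by rewrite ltr_wpDr// ltW.
have s0 : 0 < s by rewrite invr_gt0.
have s1 : s * (1 + t) = 1 by rewrite mulVf// gt_eqF.
have s1' : s <= 1 by rewrite invf_le1// lerDl ltW.
have := strongly_convex_le cD Dzt Dz' _ (eE _) (eE _) => /(_ s).
rewrite (ltW s0) s1' => /(_ isT).
have -> : s *: (z - t *: h) + (1 - s) *: z' = z.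
  have -> : z' = z + h by rewrite addrC subrK.
  apply/rowP => i; rewrite !mxE /s; field; exact: lt0r_neq0.
have -> : z - t *: h - z' = - (1 + t) *: h.
  by rewrite /h; apply/rowP => i; rewrite !mxE; ring.
rewrite eE lee_fin dotvZl dotvZr -/H => conv.
have := ub (z - t *: h).
have -> : y - (z - t *: h) = (y - z) + t *: h by rewrite opprB addrA addrAC.
rewrite dotv_sqrD !(dotvZl, dotvZr) -/H => ubt.
have gE : (2 * lambda)^-1 * (2 * (t * dotv (y - z) h)) = - t * g.
  by rewrite /g -(opprB y z) !(dotvZl, dotvNl); field; exact: lt0r_neq0.
have {}ubt : e (z - t *: h) <= e z - t * g + (2 * lambda)^-1 * (t * (t * H)).
  by rewrite ez; lra.
have conv1 : (1 + t) * e z <= e (z - t *: h) + t * e z' - kappa / 2 * t * (1 + t) * H.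
  have : (1 + t) * e z <= (1 + t) * (s * e (z - t *: h) + (1 - s) * e z' -
    kappa / 2 * s * (1 - s) * (- (1 + t) * (- (1 + t) * H))) by rewrite ler_pM2l.
  congr (_ <= _); rewrite /s; field; exact: lt0r_neq0.
rewrite -(ler_pM2l t0).
have q0 : 0 <= kappa / 2 * t * t * H by rewrite !mulr_ge0// ltW.
have : t * (t * ((2 * lambda)^-1 * H + 1)) <= t * eta by rewrite ler_pM2l.
have tt : 0 <= t * t by rewrite mulr_ge0// ltW.
lra.
Qed.

(** Completing the square: after multiplication by [k + sigma], the two sides differ exactly by the
    square of [(k + sigma) *: A - k *: C]. *)
Lemma strong_convexity_infconv sigma k (A C : 'rV[R]_n) : 0 < sigma -> 0 < k ->
  k * sigma / (k + sigma) * dotv C C <=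
  sigma * dotv A A + k * dotv (A - C) (A - C).
Proof.
move=> s0 k0; have ks0 : 0 < k + sigma by rewrite addr_gt0.
have := dotvv_ge0 ((k + sigma) *: A - k *: C).
rewrite !dotv_sqrB !(dotvZl, dotvZr) => h.
rewrite mulrAC ler_pdivrMr//; nra.
Qed.

(** Near [(xbar, vbar)] a subgradient pair of [phi] is one of [psi] with the same value, and
    [psi <= phi]. This yields prox-regularity and, at [(xbar, vbar)] itself, a local affine
    minorant. *)
Lemma variationally_convex_growth phi xbar vbar sigma :
  variationally_strongly_convex phi xbar vbar sigma ->
  exists2 eps, 0 < eps & forall x u v, eball xbar eps x ->
    limiting_subdiff phi u v -> eball xbar eps u -> eball vbar eps v ->
    (phi u < phi xbar + eps%:E)%E -> (phi u + (dotv v (x - u))%:E <= phi x)%E.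
Proof.
move=> [U [V [psi [eps0 [[Ux _ Vv _] [[psiNy _] _ psi_le psi_cvx] eps0_gt0 gphE valE]]]]].
have [e1 e1_gt0 xU] := (nbhs_eballP _ _).1 (nbhs_interior Ux).
have [e2 e2_gt0 vV] := (nbhs_eballP _ _).1 Vv.
set eps := Num.min eps0 (Num.min e1 e2).
have eps_eps0 : eps <= eps0 by rewrite ge_min lexx.
have eps_e1 : eps <= e1 by rewrite !ge_min lexx orbT.
have eps_e2 : eps <= e2 by rewrite !ge_min lexx !orbT.
exists eps; first by rewrite !lt_min eps0_gt0 e1_gt0.
move=> x u v /(sub_eball eps_e1)/xU/interior_subset Ux' uv
  /(sub_eball eps_e1)/xU Uu /(sub_eball eps_e2)/vV Vv' phiu.
have Uu' := interior_subset Uu.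
have uvG : (([set x | U x /\ (phi x < phi xbar + eps0%:E)%E] `*` V)
    `&` gph (limiting_subdiff phi)) (u, v).
  split=> //; split=> //; split=> //=; apply: (lt_le_trans phiu).
  by rewrite leeD2l// lee_fin.
rewrite (valE _ _ uvG); move: uvG; rewrite gphE => -[_ /= psiuv].
apply: le_trans (psi_le _ Ux').
apply: le_trans (limiting_subdiff_strongly_convex psiNy psi_cvx Uu psiuv Ux').
rewrite leeD2l// lee_fin lerDl mulr_ge0 ?dotvv_ge0//.
by case: psi_cvx => /ltW s0 _ _; rewrite divr_ge0.
Qed.

Lemma variationally_convex_moreau phi xbar vbar sigma lambda (f0 r : R) :
  (forall y, phi y != -oo%E) -> lower_semicontinuous phi -> phi xbar = f0%:E ->
  0 < lambda -> lambda * r <= 1 / 2 ->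
  (forall y, ((f0 + (dotv vbar (y - xbar)
     - r / 2 * dotv (y - xbar) (y - xbar)))%:E <= phi y)%E) ->
  variationally_strongly_convex phi xbar vbar sigma ->
  locally_strongly_convex (moreau_env lambda phi) (xbar + lambda *: vbar).
Proof.
move=> phiNy lsc_phi phixbar l0 lr minor.
move=> [U [V [psi [eps0 [[Ux _ Vv _] [[psiNy _] _ psi_le psi_cvx] eps0_gt0 gphE valE]]]]].
have [sigma0 _ _] := psi_cvx.
have [e1 e1_gt0 xU] := (nbhs_eballP _ _).1 (nbhs_interior Ux).
have [e2 e2_gt0 vV] := (nbhs_eballP _ _).1 Vv.
set eps := Num.min eps0 (Num.min e1 e2).
have eps_eps0 : eps <= eps0 by rewrite ge_min lexx.
have eps_e1 : eps <= e1 by rewrite !ge_min lexx orbT.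
have eps_e2 : eps <= e2 by rewrite !ge_min lexx !orbT.
have eps_gt0 : 0 < eps by rewrite !lt_min eps0_gt0 e1_gt0.
have [d d0 close] := prox_close phiNy phixbar l0 lr minor eps_gt0.
set zbar := xbar + lambda *: vbar in close *.
set k := lambda^-1; have k0 : 0 < k by rewrite invr_gt0.
(* The proximal pair of [phi] at [z] transfers to [psi]; from here on the envelope is expressed
   through [psi] alone. *)
have prox_psi z : eball zbar d z -> exists y a, [/\ eball xbar eps y, psi y = a%:E,
    moreau_env lambda phi z = (a + k / 2 * dotv (y - z) (y - z))%:E &
    limiting_subdiff psi y (k *: (z - y))].
  move=> zd; have [y zy] := prox_exists phiNy phixbar l0 lr minor z lsc_phi.
  have [yx vy phiy] := close z y zd zy.
  have ydom := prox_dom phixbar zy.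
  have [a phiyE] := edom_EFin phiNy ydom.
  have yvG : (([set x | U x /\ (phi x < phi xbar + eps0%:E)%E] `*` V)
      `&` gph (limiting_subdiff phi)) (y, k *: (z - y)).
    split; last exact/regular_limiting_subdiff/prox_regular_subdiff.
    split; last exact: vV (sub_eball eps_e2 vy).
    split; first exact: interior_subset (xU _ (sub_eball eps_e1 yx)).
    apply: (lt_le_trans phiy); rewrite phixbar -EFinD lee_fin lerD2l//.
  exists y, a; split=> //; first by rewrite -(valE _ _ yvG).
    rewrite (moreau_env_prox zy) /prox_obj phiyE enorm_sqr -EFinD.
    by rewrite (_ : (2 * lambda)^-1 = k / 2)// /k invfM mulrC.
  by move: yvG; rewrite gphE => -[].
exists (eball zbar d), (k * sigma / (k + sigma)); split; first exact: eball_nbhs.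
split; [by rewrite divr_gt0 ?mulr_gt0 ?addr_gt0|exact: eball_convex|].
move=> z0 z1 t z0d z1d t01; have /andP[t0 t1] := t01.
have [y0 [a0 [y0x psiy0 -> _]]] := prox_psi _ z0d.
have [y1 [a1 [y1x psiy1 -> _]]] := prox_psi _ z1d.
have [y [a [yx psiy -> subg]]] := prox_psi _ (eball_conv t01 z0d z1d).
have xUy w : eball xbar eps w -> U° w by move=> /(sub_eball eps_e1)/xU.
(* The subgradient inequality at the proximal point [y] of the combined point is tested at the
   combination of [y0] and [y1], where strong convexity bounds [psi] from above. *)
have := limiting_subdiff_strongly_convex psiNy psi_cvx (xUy _ yx) subg
  (interior_subset (xUy _ (eball_conv t01 y0x y1x))).
move=> /le_trans/(_ (strongly_convex_le psi_cvx (interior_subset (xUy _ y0x))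
  (interior_subset (xUy _ y1x)) t01 psiy0 psiy1)).
rewrite psiy -EFinD -!EFinB -!EFinM -EFinD !lee_fin !enorm_sqr.
have := @strong_convexity_infconv _ _ (y0 - y1) (z0 - z1) sigma0 k0.
have -> : y0 - y1 - (z0 - z1) = (y0 - z0) - (y1 - z1).
  by apply/rowP => i; rewrite !mxE; ring.
have := dotvv_ge0 (t *: y0 + (1 - t) *: y1 - y).
have := dotv_conv t (y0 - z0) (y1 - z1).
have -> : t *: (y0 - z0) + (1 - t) *: (y1 - z1) =
   (t *: y0 + (1 - t) *: y1 - y) - (t *: z0 + (1 - t) *: z1 - y).
  by apply/rowP => i; rewrite !mxE; ring.
rewrite dotv_conv.
have -> : y - (t *: z0 + (1 - t) *: z1) = - (t *: z0 + (1 - t) *: z1 - y).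
  by rewrite opprB.
move: (t *: y0 + (1 - t) *: y1 - y) (t *: z0 + (1 - t) *: z1 - y) => p q.
rewrite (dotv_sqrB p q) dotvNl dotvNr opprK dotvZl (dotvC q p).
move: (k * sigma / (k + sigma)) (dotv p p) (dotv q q) (dotv p q)
  (dotv (y0 - z0) (y0 - z0)) (dotv (y1 - z1) (y1 - z1)) (dotv (_ - _) (_ - _))
  (dotv (_ - _) (_ - _)) (dotv (_ - _) (_ - _)) => kap P Q pq Y0 Y1 B C A.
move=> S P0 infconv ineq.
have T0 : 0 <= t * (1 - t) by rewrite mulr_ge0// subr_ge0.
(* The gains [sigma * |y0 - y1|^2] from [psi] and [k * |(y0 - z0) - (y1 - z1)|^2] from the squares
   both carry the weight [t * (1 - t)]; together they dominate the gain required in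
   [|z0 - z1|^2]. *)
have := ler_wpM2l T0 infconv.
have := congr1 (fun s => k * s) S.
have : 0 <= k * P by rewrite mulr_ge0// ltW.
have : 0 <= sigma * P by rewrite mulr_ge0// ltW.
lra.
Qed.

End MoreauConvexity.

(** * Suprema of quadratics with a common curvature *)

Section SupQuadratics.
Context {R : realType} {n : nat}.
Implicit Types (phi psi : 'rV[R]_n -> \bar R) (u v w x y z : 'rV[R]_n).
Implicit Types (G : set ('rV[R]_n * 'rV[R]_n)) (p : 'rV[R]_n * 'rV[R]_n).

(** The index [p] is meant to be a subgradient pair, at which [phi p.1] is finite when [phi] avoids
    [-oo], so [fine] then loses nothing. *)
Definition quadratic_minorant phi (kappa : R) p x : R :=
  fine (phi p.1) + (dotv p.2 (x - p.1) + kappa / 2 * dotv (x - p.1) (x - p.1)).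

Definition sup_quadratics phi kappa G x : \bar R :=
  ereal_sup [set (quadratic_minorant phi kappa p x)%:E | p in G].

Lemma sup_quadratics_ge phi kappa G p x : G p ->
  ((quadratic_minorant phi kappa p x)%:E <= sup_quadratics phi kappa G x)%E.
Proof. by move=> Gp; apply: ereal_sup_ubound; exists p. Qed.

Lemma sup_quadratics_lsc phi kappa G : lower_semicontinuous (sup_quadratics phi kappa G).
Proof.
move=> x a /ereal_sup_gt[_ [p Gp <-]]; rewrite lte_fin => ap.
exists [set y | a < quadratic_minorant phi kappa p y].
  have px := @cvg_subr _ _ p.1 x.
  have qx : quadratic_minorant phi kappa p y @[y --> x] -->
      quadratic_minorant phi kappa p x.
    exact: (cvgD (cvg_cst _) (cvgD (cvg_dotv (cvg_cst _) px)
      (cvgM (cvg_cst _) (cvg_dotv px px)))).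
  exact: cvgr_gt qx _ ap.
by move=> y /= ay; apply: lt_le_trans (sup_quadratics_ge _ _ _ Gp); rewrite lte_fin.
Qed.

(** Subtracting [kappa / 2 * |x|^2] turns every quadratic into an affine function, and a supremum of
    affine functions is convex. *)
Lemma sup_quadratics_strongly_convex phi kappa G (D : set 'rV[R]_n) :
  0 < kappa -> convex_set (D : set (convex_lmodType 'rV[R]_n)) ->
  strongly_convex_on D kappa (sup_quadratics phi kappa G).
Proof.
move=> k0 cD; split=> // x y t _ _ /andP[t0 t1]; rewrite leeBlDr//.
apply: ge_ereal_sup => _ [p Gp <-]; rewrite -leeBlDr// -EFinB !enorm_sqr.
have -> : quadratic_minorant phi kappa p (t *: x + (1 - t) *: y)
    - kappa / 2 * dotv (t *: x + (1 - t) *: y) (t *: x + (1 - t) *: y)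
  = t * (quadratic_minorant phi kappa p x - kappa / 2 * dotv x x)
  + (1 - t) * (quadratic_minorant phi kappa p y - kappa / 2 * dotv y y).
  rewrite /quadratic_minorant.
  have -> : t *: x + (1 - t) *: y - p.1 = t *: (x - p.1) + (1 - t) *: (y - p.1).
    by apply/rowP => i; rewrite !mxE; ring.
  rewrite !dotv_conv (dotvDr (t *: (x - p.1))) !dotvZr.
  have -> : x - p.1 - (y - p.1) = x - y by apply/rowP => i; rewrite !mxE; ring.
  ring.
rewrite EFinD 2!EFinM; apply: leeD; apply: lee_wpmul2l; rewrite ?lee_fin ?subr_ge0//.
  by rewrite EFinB leeB// sup_quadratics_ge.
by rewrite EFinB leeB// sup_quadratics_ge.
Qed.

End SupQuadratics.

(** * From strong convexity of the envelope to variational strong convexity *)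

Section Converse.
Context {R : realType} {n : nat}.
Implicit Types (phi psi : 'rV[R]_n -> \bar R) (u v w x y z : 'rV[R]_n).

(** Adding the prox-regularity inequality at [y] to the comparison of [y] with [u] gives
    [(lambda^-1 - r) * |y - u|^2 <= 0], and [lambda * r <= 1 / 2] makes the factor positive. *)
Lemma prox_regular_is_prox phi lambda (r b : R) u v y :
  (forall y, phi y != -oo%E) -> 0 < lambda -> lambda * r <= 1 / 2 ->
  phi u = b%:E -> is_prox lambda phi (u + lambda *: v) y ->
  (phi u + (dotv v (y - u) - r / 2 * enorm (y - u) ^+ 2)%:E <= phi y)%E ->
  y = u.
Proof.
move=> phiNy l0 lr phiu /(_ u); rewrite /prox_obj phiu.
case: (phi y) (phiNy y) => [c _|//|//].
rewrite -!EFinD !lee_fin !enorm_sqr.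
have -> : y - (u + lambda *: v) = (y - u) - lambda *: v by rewrite opprD addrA.
have -> : u - (u + lambda *: v) = - (lambda *: v) by rewrite opprD addrA subrr sub0r.
move=> h1 h2; apply/eqP; rewrite -subr_eq0; apply/eqP/dotvv_eq0.
move: h1 h2; rewrite (dotv_sqrB (y - u)) dotvNl dotvNr opprK !(dotvZl, dotvZr).
rewrite (dotvC v); have := dotvv_ge0 (y - u).
move: (dotv (y - u) (y - u)) (dotv _ v) (dotv v v) => D dv vv D0.
have -> : (2 * lambda)^-1 = lambda^-1 / 2 by rewrite invfM mulrC.
have lV : lambda * lambda^-1 = 1 by rewrite mulfV// gt_eqF.
have k0 : 0 < lambda^-1 by rewrite invr_gt0.
move: (lambda^-1) lV k0 => k lV k0 h1 h2.
have kdv : k * (lambda * dv) = dv by rewrite mulrA (mulrC k) lV mul1r.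
have h3 : k / 2 * D - r / 2 * D <= 0 by lra.
have h4 : lambda * (k / 2 * D - r / 2 * D) <= 0 by rewrite pmulr_rle0.
have kD : lambda * (k * D) = D by rewrite mulrA lV mul1r.
have : 0 <= (1 / 2 - lambda * r) * D by rewrite mulr_ge0// subr_ge0.
lra.
Qed.

(** With the test point [x + lambda *: v], the bounds on both envelope values carry the same term
    [lambda / 2 * |v|^2], which cancels. *)
Lemma moreau_convex_growth phi lambda (e : 'rV[R]_n -> R) (D : set 'rV[R]_n)
    (kappa a : R) u v x :
  (forall y, phi y != -oo%E) -> 0 < lambda ->
  (forall w, moreau_env lambda phi w = (e w)%:E) ->
  strongly_convex_on D kappa (moreau_env lambda phi) ->
  nbhs (u + lambda *: v) D -> D (x + lambda *: v) ->
  is_prox lambda phi (u + lambda *: v) u -> phi u = a%:E ->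
  ((a + (dotv v (x - u) + kappa / 2 * dotv (x - u) (x - u)))%:E <= phi x)%E.
Proof.
move=> phiNy l0 eE cD Dz Dz' uprox phiu.
have := moreau_env_subgradient l0 eE cD Dz Dz' uprox phiu.
have -> : u + lambda *: v - u = lambda *: v by rewrite addrC addKr.
have -> : x + lambda *: v - (u + lambda *: v) = x - u.
  by apply/rowP => i; rewrite !mxE; ring.
rewrite scalerA mulVf ?gt_eqF// scale1r.
have ez : e (u + lambda *: v) = a + (2 * lambda)^-1 * dotv (lambda *: v) (lambda *: v).
  apply: EFin_inj; rewrite -eE (moreau_env_prox uprox) /prox_obj phiu enorm_sqr.
  by rewrite opprD addrA subrr sub0r dotvNl dotvNr opprK.
have : (moreau_env lambda phi (x + lambda *: v) <=
    phi x + ((2 * lambda)^-1 * dotv (lambda *: v) (lambda *: v))%:E)%E.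
  apply: ereal_inf_lbound; exists x => //.
  by rewrite enorm_sqr opprD addrA subrr sub0r dotvNl dotvNr opprK.
rewrite eE; case: (phi x) (phiNy x) => [c _| _ _ _|//]; last by rewrite leey.
rewrite -EFinD !lee_fin ez; lra.
Qed.

Lemma moreau_convex_variational phi xbar vbar lambda (f0 r r0 e0 : R) :
  (forall y, phi y != -oo%E) -> lower_semicontinuous phi -> phi xbar = f0%:E ->
  limiting_subdiff phi xbar vbar ->
  0 < lambda -> lambda * r <= 1 / 2 -> lambda * r0 <= 1 / 2 -> 0 < e0 ->
  (forall y, ((f0 + (dotv vbar (y - xbar)
     - r / 2 * dotv (y - xbar) (y - xbar)))%:E <= phi y)%E) ->
  (forall x u v, eball xbar e0 x ->
    (gph (limiting_subdiff phi) `&` (eball xbar e0 `*` eball vbar e0)) (u, v) ->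
    (phi u < phi xbar + e0%:E)%E ->
    (phi u + (dotv v (x - u) - r0 / 2 * enorm (x - u) ^+ 2)%:E <= phi x)%E) ->
  locally_strongly_convex (moreau_env lambda phi) (xbar + lambda *: vbar) ->
  exists sigma, 0 < sigma /\ variationally_strongly_convex phi xbar vbar sigma.
Proof.
move=> phiNy lsc_phi phixbar subg l0 lr lr0 e0_gt0 minor proxreg [D [kappa [Dz cD]]].
have [k0 _ _] := cD.
have close := prox_close phiNy phixbar l0 lr minor.
have ex z := prox_exists phiNy phixbar l0 lr minor z lsc_phi.
set zbar := xbar + lambda *: vbar in Dz close.
have [e eE] : exists e : 'rV[R]_n -> R, forall w, moreau_env lambda phi w = (e w)%:E.
  exists (fun w => fine (moreau_env lambda phi w)) => w.
  have [y wy] := ex w; have [a phiy] := edom_EFin phiNy (prox_dom phixbar wy).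
  by rewrite (moreau_env_prox wy) /prox_obj phiy.
have [d1 d1_gt0 zD] := (nbhs_eballP _ _).1 (nbhs_interior Dz).
have [d2 d2_gt0 close_e0] := close _ e0_gt0.
(* [c] controls how far [x + lambda *: v] moves from [zbar] when [x] and [v] both vary within the
   same radius. *)
set c := 1 + lambda; have c0 : 0 < c by rewrite addr_gt0.
have zball s x v d : s * c <= d -> eball xbar s x -> eball vbar s v ->
    eball zbar d (x + lambda *: v).
  move=> sd; rewrite /eball /= => xs vs; apply: le_trans sd.
  have -> : x + lambda *: v - zbar = (x - xbar) + lambda *: (v - vbar).
    by rewrite scalerBr addrACA -opprD.
  apply: le_trans (enormD _ _) _; rewrite enormZ gtr0_norm// /c mulrDr mulr1.
  by rewrite lerD// mulrC ler_wpM2r// ltW.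
(* Pairs within [e1] are sent into the [d1]-ball, where the envelope is strongly convex, and into
   the [d2]-ball, whose proximal points stay within the radius [e0] of prox-regularity. *)
set e1 := Num.min e0 (Num.min (d1 / c) (d2 / c)).
have e1_gt0 : 0 < e1 by rewrite !lt_min e0_gt0/= !divr_gt0.
have e1e0 : e1 <= e0 by rewrite ge_min lexx.
have e1d1 : e1 * c <= d1 by rewrite -ler_pdivlMr// !ge_min lexx !orbT.
have e1d2 : e1 * c <= d2 by rewrite -ler_pdivlMr// !ge_min lexx !orbT.
have [d3 d3_gt0 close_e1] := close _ e1_gt0.
(* Pairs within [e2] are sent to points whose proximal pairs lie within [e1], hence in the index set
   [G] below. *)
set e2 := Num.min e1 (d3 / c).
have e2_gt0 : 0 < e2 by rewrite lt_min e1_gt0/= !divr_gt0.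
have e2e1 : e2 <= e1 by rewrite ge_min lexx.
have e2d3 : e2 * c <= d3 by rewrite -ler_pdivlMr// ge_min lexx orbT.
pose G := [set p : 'rV[R]_n * 'rV[R]_n | [/\ limiting_subdiff phi p.1 p.2,
  eball xbar e1 p.1, eball vbar e1 p.2 & (phi p.1 < (f0 + e1)%:E)%E]].
have Gfin u v : G (u, v) -> exists a, phi u = a%:E.
  by move=> [[udom _] _ _ _]; exact: edom_EFin.
(* Some proximal point [y] exists; prox-regularity at [(u, v)], tested at [y], identifies it with
   [u]. *)
have Gprox u v : G (u, v) -> is_prox lambda phi (u + lambda *: v) u.
  move=> Guv; have [a phiu] := Gfin _ _ Guv; have [/= uv ux vv phiu_lt] := Guv.
  have [y uy] := ex (u + lambda *: v).
  suff yu : y = u by rewrite yu in uy.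
  apply: (prox_regular_is_prox phiNy l0 lr0 phiu uy).
  apply: proxreg.
  - by have [] := close_e0 _ _ (zball _ _ _ _ e1d2 ux vv) uy.
  - by split=> //; split; apply: sub_eball e1e0 _ _.
  - by rewrite phixbar -EFinD (lt_le_trans phiu_lt)// lee_fin lerD2l.
have growth u v x : G (u, v) -> eball xbar e1 x ->
    ((quadratic_minorant phi kappa (u, v) x)%:E <= phi x)%E.
  move=> Guv xx; have [a phiu] := Gfin _ _ Guv; have [/= _ ux vv _] := Guv.
  rewrite /quadratic_minorant /= phiu /=.
  apply: (moreau_convex_growth phiNy l0 eE cD _ _ (Gprox _ _ Guv) phiu).
    exact: zD (zball _ _ _ _ e1d1 ux vv).
  exact: interior_subset (zD _ (zball _ _ _ _ e1d1 xx vv)).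
set psi := sup_quadratics phi kappa G.
have Gbar : G (xbar, vbar).
  split=> //=; try exact: eball_center (ltW e1_gt0).
  by rewrite phixbar lte_fin ltrDl.
have psi_le x : eball xbar e1 x -> (psi x <= phi x)%E.
  by move=> xx; apply: ge_ereal_sup => _ [[u v] Guv <-]; exact: growth.
have psiNy x : psi x != -oo%E.
  by rewrite -ltNye (lt_le_trans _ (sup_quadratics_ge _ _ _ Gbar))// ltNyr.
have psiG u v : G (u, v) -> psi u = phi u.
  move=> Guv; have [a phiu] := Gfin _ _ Guv; have [/= _ ux _ _] := Guv.
  apply/le_anti; rewrite psi_le//=; apply: le_trans (sup_quadratics_ge _ _ _ Guv).
  rewrite /quadratic_minorant /= subrr phiu /= lee_fin lerDl.
  by rewrite !dotv0r mulr0 addr0.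
have psi_subg u v : G (u, v) -> limiting_subdiff psi u v.
  move=> Guv; have [a phiu] := Gfin _ _ Guv.
  apply: regular_limiting_subdiff.
  apply: (@regular_subdiff_quadratic _ _ _ _ _ 0) => //.
    by rewrite /edom /= (psiG _ _ Guv) phiu ltry.
  apply: filterE => y; rewrite (psiG _ _ Guv).
  apply: le_trans (sup_quadratics_ge _ _ _ Guv).
  rewrite /quadratic_minorant /= phiu /= -EFinD lee_fin mul0r subr0 addrA lerDl.
  by rewrite mulr_ge0 ?dotvv_ge0// divr_ge0// ltW.
have psi_cvx E : convex_set (E : set (convex_lmodType 'rV[R]_n)) ->
    strongly_convex_on E kappa psi by exact: sup_quadratics_strongly_convex.
(* Minty parametrization: a subgradient pair [(x, v)] of [psi] near
   [(xbar, vbar)] is recovered from [x + lambda *: v] by the proximal map. *)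
have minty x v : eball xbar e2 x -> eball vbar e2 v -> limiting_subdiff psi x v ->
    G (x, v).
  move=> xx vv psixv; have [y zy] := ex (x + lambda *: v).
  have zd := zball _ _ _ _ e2d3 xx vv.
  have [yx wv phiy] := close_e1 _ _ zd zy.
  set w := lambda^-1 *: _ in wv.
  have Gyw : G (y, w).
    split=> //=; apply/regular_limiting_subdiff/prox_regular_subdiff => //.
    exact: (prox_dom phixbar zy).
  suff [-> ->] : x = y /\ v = w by [].
  have cT := psi_cvx setT (fun _ _ _ _ _ => mem_set I).
  have nT z : nbhs z [set: 'rV[R]_n] by exact: filterT.
  have := limiting_subdiff_strongly_convex psiNy cT (nT _) psixv (I : setT y).
  have := limiting_subdiff_strongly_convex psiNy cT (nT _) (psi_subg _ _ Gyw) (I : setT x).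
  have [a ->] := edom_EFin psiNy psixv.1.
  have [b ->] := edom_EFin psiNy (psi_subg _ _ Gyw).1.
  rewrite -!EFinD !lee_fin => ineq1 ineq2.
  (* Both pairs have the same image [x + lambda *: v]. Adding the two subgradient inequalities
     therefore gives [lambda * |w - v|^2 + kappa * |x - y|^2 <= 0], so the pairs coincide. *)
  have xy : x - y = lambda *: (w - v).
    rewrite scalerBr /w scalerA mulfV ?gt_eqF// scale1r.
    by apply/rowP => i; rewrite !mxE; ring.
  move: ineq1 ineq2; rewrite -(opprB x y) !dotvNr dotvNl opprK.
  have D0 := dotvv_ge0 (x - y).
  have W0 := dotvv_ge0 (w - v).
  have mono : dotv w (x - y) - dotv v (x - y) = lambda * dotv (w - v) (w - v).
    by rewrite -dotvNl -dotvDl {1}xy dotvZr.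
  move=> ineq1 ineq2.
  have lW0 : 0 <= lambda * dotv (w - v) (w - v) by rewrite mulr_ge0// ltW.
  have kD0 : 0 <= kappa * dotv (x - y) (x - y) by rewrite mulr_ge0// ltW.
  split; apply/eqP; rewrite -subr_eq0; apply/eqP.
    by apply: dotvv_eq0; rewrite -(pmulr_rle0 _ k0); lra.
  rewrite -(opprB w v) (_ : w - v = 0) ?oppr0//.
  by apply: dotvv_eq0; rewrite -(pmulr_rle0 _ l0); lra.
exists kappa; split=> //.
(* The neighbourhoods have radius [e2] but the level is [e1]: pairs of [phi] there belong to [G]
   because [e2 <= e1], and [minty] puts pairs of [psi] into [G], whose members satisfy the level
   bound for [e1]. *)
exists (eball xbar e2), (eball vbar e2), psi, e1; split=> //.
- by split; [exact: eball_nbhs|exact: eball_convex|exact: eball_nbhs|exact: eball_convex].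
- split.
  + by split=> //; exists xbar; rewrite /edom /= (psiG _ _ Gbar) phixbar ltry.
  + exact: sup_quadratics_lsc.
  + by move=> x xx; apply: psi_le; exact: sub_eball xx.
  + exact/psi_cvx/eball_convex.
- apply/seteqP; split=> -[x v] [[/= xx vv] xv]; split=> //=.
  + by split=> //; exact: xx.1.
  + apply: psi_subg; case: xx => xx phix; split=> //=; try exact: sub_eball e2e1 _ _.
    by rewrite EFinD -phixbar.
  + by have [_ _ _] := minty _ _ xx vv xv; rewrite EFinD -phixbar.
  + by have [] := minty _ _ xx vv xv.
- move=> x v [[/= [xx phix] vv] xv]; apply/esym/(psiG x v).
  split=> //=; try exact: sub_eball e2e1 _ _.
  by rewrite EFinD -phixbar.
Qed.

End Converse.

(** * Choice of [lambda] and assembly of the two implications *)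

Unset Implicit Arguments.

Theorem theorem4p5 (R : realType) (n : nat) (phi : 'rV[R]_n -> \bar R)
    (xbar vbar : 'rV[R]_n)
    (phi_proper : proper_fun phi)
    (phi_lsc : lower_semicontinuous phi)
    (phi_prox_bounded : prox_bounded phi)
    (xbar_dom : edom phi xbar)
    (vbar_subdiff : limiting_subdiff phi xbar vbar) :
  (exists sigma : R,
     0 < sigma /\ variationally_strongly_convex phi xbar vbar sigma)
  <->
  (prox_regular phi xbar vbar /\
   \forall lambda \near (0 : R)^'+,
     locally_strongly_convex (moreau_env lambda phi) (xbar + lambda *: vbar)).
Proof.
have [phiNy _] := phi_proper.
have [f0 phixbar] := edom_EFin phiNy xbar_dom.
split=> [[sigma [_ vsc]]|[[eps [r [eps0 r0 proxreg]]] cvx]].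
- have [eps eps0 growth] := variationally_convex_growth vsc.
  split.
    exists eps, 0; split=> // x u v xx [/= uv [ux vv]] phiu.
    by rewrite mul0r mul0r subr0; exact: growth.
  have [|r r0 minor] := @global_minorant _ _ phi xbar vbar f0 0 eps phiNy
      phi_prox_bounded eps0 (lexx _).
    move=> y yx; rewrite mul0r mul0r subr0 EFinD -phixbar; apply: growth => //.
    + exact: eball_center (ltW eps0).
    + exact: eball_center (ltW eps0).
    + by rewrite phixbar lte_fin ltrDl.
  (* Below this threshold [lambda * r <= 1 / 2]; the added [1] keeps it meaningful when [r = 0]. *)
  have c0 : 0 < (2 * (r + 1))^-1 by rewrite invr_gt0 mulr_gt0// ltr_wpDl.
  near=> lambda.
  have l0 : 0 < lambda by [].
  apply: variationally_convex_moreau minor vsc => //.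
  have : lambda <= (2 * (r + 1))^-1 by near: lambda; exact: nbhs_right_le.
  rewrite -[leRHS]mul1r ler_pdivlMr ?mulr_gt0 ?ltr_wpDl//; lra.
- have [|r1 r10 minor] := @global_minorant _ _ phi xbar vbar f0 r eps phiNy
      phi_prox_bounded eps0 r0.
    move=> y yx; rewrite EFinD -phixbar -enorm_sqr; apply: proxreg => //.
    + by split=> //; split; exact: eball_center (ltW eps0).
    + by rewrite phixbar lte_fin ltrDl.
  (* The sum [r + r1] lets a single [lambda] meet the smallness condition for the prox-regularity
     constant [r] and for the minorant constant [r1]. *)
  have c0 : 0 < (2 * (r + r1 + 1))^-1.
    by rewrite invr_gt0 mulr_gt0// ltr_wpDl// addr_ge0.
  have [lambda [l0 lc lcvx]] : exists lambda, [/\ 0 < lambda,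
      lambda <= (2 * (r + r1 + 1))^-1 &
      locally_strongly_convex (moreau_env lambda phi) (xbar + lambda *: vbar)].
    apply: (@filter_ex _ (0 : R)^'+); near=> lambda; split => //.
      by near: lambda; exact: nbhs_right_le.
    by near: lambda.
  have lb : lambda * (2 * (r + r1 + 1)) <= 1.
    by move: lc; rewrite -[leRHS]mul1r ler_pdivlMr// mulr_gt0// ltr_wpDl// addr_ge0.
  have lr0 : 0 <= lambda * r by rewrite mulr_ge0// ltW.
  have lr1 : 0 <= lambda * r1 by rewrite mulr_ge0// ltW.
  apply: moreau_convex_variational minor proxreg lcvx => //; lra.
Unshelve. all: by end_near. Qed.
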